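(* Let $A,B\in\mathcal{L}(\mathcal{H})$ be indefinite selfadjoint operators. Given $\beta\in\mathbb{R}$ and $(a,b)\in\mathcal{H}\times\mathcal{H}$, the following conditions are equivalent: (i) $\mathcal{W}(\beta,a,b)\neq\varnothing$; (ii) $\mathcal{Z}(\beta,a,b)\neq\varnothing$ and $\lambda_->0$. In this case, $\mathcal{W}(\beta,a,b)=\mathcal{Z}(\beta,a,b)$.
   Context: $\mathcal{H}$ is a complex separable Hilbert space with inner product $\langle\cdot,\cdot\rangle$; $\mathcal{L}(\mathcal{H})$ is the algebra of bounded linear operators on $\mathcal{H}$. A selfadjoint operator is indefinite if it is neither positive semidefinite nor negative semidefinite. Set $f(x)=\langle Ax,x\rangle+2\operatorname{Re}\langle a,x\rangle$ and $g(x)=\langle Bx,x\rangle+2\operatorname{Re}\langle b,x\rangle$ for $x\in\mathcal{H}$. $\mathcal{W}(\beta,a,b)$ is the set of solutions (global minimizers) of: minimize $f(x)$ subject to $g(x)\leq\beta$. $\mathcal{Z}(\beta,a,b)$ is the set of solutions (global minimizers) of: minimize $f(x)$ subject to $g(x)=\beta$. $\lambda_-=-\inf\left\{\frac{\langle Ax,x\rangle}{\langle Bx,x\rangle}: x\in\mathcal{H},\ \langle Bx,x\rangle>0\right\}$. (If the set $I_\geq(A,B)=\{\lambda\in\mathbb{R}: A+\lambda B\text{ is positive semidefinite}\}$ is nonempty, it is a closed bounded interval whose left endpoint is $\lambda_-$.) *)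

(* Defs.v *)
From HB Require Import structures.
From mathcomp Require Import all_boot all_order all_algebra.
From mathcomp Require Import sesquilinear complex.
From mathcomp Require Import all_classical all_reals all_analysis.

Set Implicit Arguments.
Unset Strict Implicit.
Unset Printing Implicit Defensive.

Import Order.TTheory GRing.Theory Num.Theory.
Import numFieldNormedType.Exports.

Local Open Scope classical_set_scope.
Local Open Scope complex_scope.
Local Open Scope ring_scope.

(* A Hilbert space is a complete normed space whose norm comes from an inner
   product; the forms of type {dot H for Num.conj} are linear in the first
   argument and conjugate-linear in the second.  The order on R[i] is partial:
   0 <= z says that z is real and nonnegative. *)
Definition inner_product_norm (R : realType) (H : completeNormedModType R[i])
    (dot : {dot H for (@Num.conj R[i])}) : Prop :=
  forall x : H, `|x| ^+ 2 = dot x x.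

Definition separable_space (T : topologicalType) : Prop :=
  exists2 D : set T, countable D & dense D.

Definition bounded_operator (R : realType) (H : completeNormedModType R[i])
    (A : {linear H -> H}) : Prop :=
  exists M : R, forall x : H, `|A x| <= M%:C * `|x|.

Definition selfadjoint (R : realType) (H : completeNormedModType R[i])
    (dot : {dot H for (@Num.conj R[i])}) (A : {linear H -> H}) : Prop :=
  forall x y : H, dot (A x) y = dot x (A y).

Definition possemidef (R : realType) (H : completeNormedModType R[i])
    (dot : {dot H for (@Num.conj R[i])}) (A : {linear H -> H}) : Prop :=
  forall x : H, 0 <= dot (A x) x.

Definition negsemidef (R : realType) (H : completeNormedModType R[i])
    (dot : {dot H for (@Num.conj R[i])}) (A : {linear H -> H}) : Prop :=
  forall x : H, dot (A x) x <= 0.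

Definition indefinite (R : realType) (H : completeNormedModType R[i])
    (dot : {dot H for (@Num.conj R[i])}) (A : {linear H -> H}) : Prop :=
  ~ possemidef dot A /\ ~ negsemidef dot A.

(* For selfadjoint A the number <A x, x> is real; complex.Re only moves it from
   R[i] to R. *)
Definition qform (R : realType) (H : completeNormedModType R[i])
    (dot : {dot H for (@Num.conj R[i])}) (A : {linear H -> H}) (x : H) : R :=
  complex.Re (dot (A x) x).

Definition quadfun (R : realType) (H : completeNormedModType R[i])
    (dot : {dot H for (@Num.conj R[i])}) (A : {linear H -> H}) (a : H)
    (x : H) : R :=
  qform dot A x + 2 * complex.Re (dot a x).

Definition minimizers (R : realType) (T : Type) (f : T -> R) (D : set T) :
    set T :=
  [set x | D x /\ forall y : T, D y -> f x <= f y].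

Definition Wset (R : realType) (H : completeNormedModType R[i])
    (dot : {dot H for (@Num.conj R[i])}) (A B : {linear H -> H})
    (beta : R) (a b : H) : set H :=
  minimizers (quadfun dot A a) [set x | quadfun dot B b x <= beta].

Definition Zset (R : realType) (H : completeNormedModType R[i])
    (dot : {dot H for (@Num.conj R[i])}) (A B : {linear H -> H})
    (beta : R) (a b : H) : set H :=
  minimizers (quadfun dot A a) [set x | quadfun dot B b x = beta].

(* The infimum is taken in \bar R: it can be -oo, and then lambda_minus is
   +oo. *)
Definition lambda_minus (R : realType) (H : completeNormedModType R[i])
    (dot : {dot H for (@Num.conj R[i])}) (A B : {linear H -> H}) : \bar R :=
  (- ereal_inf [set (qform dot A x / qform dot B x)%:E |
                  x in [set x : H | (0 < qform dot B x)%R]])%E.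

(* Main.v *)
Require Import Defs.
From HB Require Import structures.
From mathcomp Require Import all_boot all_order all_algebra.
From mathcomp Require Import sesquilinear complex.
From mathcomp Require Import all_classical all_reals all_analysis.
From mathcomp Require Import ring lra.

Set Implicit Arguments.
Unset Strict Implicit.

Import Order.TTheory GRing.Theory Num.Theory.
Import numFieldNormedType.Exports.

Local Open Scope classical_set_scope.
Local Open Scope complex_scope.
Local Open Scope ring_scope.

(** On a real line [x + t v], both functions are quadratic polynomials in [t]
    whose leading coefficients are the values of the quadratic forms at [v],
    independently of [x].  The equivalence reduces to choosing the direction
    [v] well and deciding how far to go along it.  Replacing [v] by [- v]
    changes the signs of the linear coefficients and keeps the leading ones, so
    one chosen linear coefficient may always be taken nonpositive
    ([exists_slope_le0]).

    Let [w] minimize [f] on [g <= beta] and let [v] satisfy [<A v, v> < 0].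
    If [g w < beta], a short step along [v] stays feasible and lowers [f];
    hence [g w = beta] ([Wset_active]), and [W = Z] follows.  If
    [<B v, v> <= 0], a long step along [v] does not raise [g] and lowers [f];
    hence [<B v, v> > 0] ([Wset_qform_gt0]).  Such a [v] exists because [A] is
    indefinite, and a vector with [<A v, v> < 0 < <B v, v>] is precisely a
    witness of [lambda_- > 0] ([lambda_minus_gt0P]).

    Conversely, given such a [v] and a minimizer [z] of [f] on [g = beta], a
    point [y] with [g y < beta] can be moved along [v] until [g = beta], since
    [g] tends to infinity in both directions.  In the direction in which [f]
    has nonpositive slope, [f] is concave and decreases, so it ends at a value
    at least [f z]; hence [f z <= f y] ([Zset_sub_Wset]). *)

Lemma exists_quadratic_le (R : realFieldType) (d e m : R) : 0 < m ->
  exists2 t, 0 < t & t * d + t ^+ 2 * e <= m.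
Proof.
move=> m_gt0.
have d_abs := ler_norm d; have e_abs := ler_norm e.
have d_ge0 := normr_ge0 d; have e_ge0 := normr_ge0 e.
have s_gt0 : 0 < m + `|d| + `|e| by lra.
(* As 0 < t <= 1, the polynomial is at most t (|d| + |e|), which is <= m. *)
pose t := m / (m + `|d| + `|e|).
have t_gt0 : 0 < t by rewrite divr_gt0.
have tE : t * (m + `|d| + `|e|) = m by rewrite mulfVK ?gt_eqF.
exists t => //; nra.
Qed.

Lemma exists_quadratic_lt0 (R : realFieldType) (c k : R) : k < 0 ->
  exists2 t, 0 < t & t * c + t ^+ 2 * k < 0.
Proof.
move=> k_lt0; have c_abs := ler_norm c; have c_ge0 := normr_ge0 c.
(* Beyond |c| / (- k), the quadratic term outweighs the linear one. *)
pose t := (`|c| + 1) / (- k).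
have t_gt0 : 0 < t by rewrite divr_gt0; lra.
have tE : t * (- k) = `|c| + 1 by rewrite mulfVK // oppr_eq0 lt_eqF.
exists t => //; nra.
Qed.

Lemma exists_quadratic_eq (R : rcfType) (d e m : R) : 0 < e -> 0 < m ->
  exists2 t, 0 < t & t * d + t ^+ 2 * e = m.
Proof.
move=> e_gt0 m_gt0.
have em_gt0 : 0 < e * m by rewrite mulr_gt0.
pose s := Num.sqrt (d ^+ 2 + 4 * (e * m)).
have s_ge0 : 0 <= s by exact: sqrtr_ge0.
have s2 : s ^+ 2 = d ^+ 2 + 4 * (e * m) by rewrite sqr_sqrtr // addr_ge0 ?sqr_ge0 //; lra.
have ds : d < s by rewrite ltNge; apply/negP => sd; nra.
(* The larger root; it is positive because the roots have product - m / e. *)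
exists ((s - d) / (2 * e)).
  by rewrite divr_gt0 //; lra.
have -> : (s - d) / (2 * e) * d + ((s - d) / (2 * e)) ^+ 2 * e =
    (s ^+ 2 - d ^+ 2) / (4 * e) by field; rewrite gt_eqF.
by rewrite s2; field; rewrite gt_eqF.
Qed.

Section QuadraticFunctions.
Context {R : realType} {H : completeNormedModType R[i]}.
Variable dot : {dot H for (@Num.conj R[i])}.
Implicit Types (A B : {linear H -> H}) (a b u v w x y z : H) (t : R).

(** The derivative of [quadfun dot A a] at [x] along [v], for selfadjoint [A]. *)
Definition slope A a x v : R := 2 * complex.Re (dot (A x + a) v).

Lemma Re_conj (z : R[i]) : complex.Re (Num.conj z) = complex.Re z.
Proof. by case: z. Qed.

Lemma Re_add (p q : R[i]) : complex.Re (p + q) = complex.Re p + complex.Re q.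
Proof. by case: p q => ? ? []. Qed.

Lemma Re_realM t (z : R[i]) : complex.Re (t%:C * z) = t * complex.Re z.
Proof. by case: z => p q /=; rewrite mul0r subr0. Qed.

Lemma Re_dotC x y : complex.Re (dot x y) = complex.Re (dot y x).
Proof. rewrite (hermC dot x y) expr0 mul1r. exact: Re_conj. Qed.

Lemma Re_dotDl x y z :
  complex.Re (dot (x + y) z) = complex.Re (dot x z) + complex.Re (dot y z).
Proof. by rewrite linearDl Re_add. Qed.

Lemma Re_dotZl x y t : complex.Re (dot (t%:C *: x) y) = t * complex.Re (dot x y).
Proof. by rewrite linearZl_LR Re_realM. Qed.

Lemma Re_dotDr x y z :
  complex.Re (dot x (y + z)) = complex.Re (dot x y) + complex.Re (dot x z).
Proof. by rewrite Re_dotC Re_dotDl ![_ (dot _ x)]Re_dotC. Qed.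

Lemma Re_dotZr x y t : complex.Re (dot x (t%:C *: y)) = t * complex.Re (dot x y).
Proof. by rewrite Re_dotC Re_dotZl Re_dotC. Qed.

Lemma quadfun_line A a x v t : selfadjoint dot A ->
  quadfun dot A a (x + t%:C *: v) =
    quadfun dot A a x + t * slope A a x v + t ^+ 2 * qform dot A v.
Proof.
move=> Asa.
have sym : complex.Re (dot (A v) x) = complex.Re (dot (A x) v).
  by rewrite Asa Re_dotC.
rewrite /quadfun /qform /slope (linearD A) (linearZ_LR A) /=.
rewrite !(Re_dotDl, Re_dotDr, Re_dotZl, Re_dotZr) sym; ring.
Qed.

Lemma exists_slope_le0 A a x v :
  exists2 u, slope A a x u <= 0 & forall B, qform dot B u = qform dot B v.
Proof.
have [le0|gt0] := leP (slope A a x v) 0; first by exists v.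
exists ((- 1)%:C *: v) => [|B].
  by rewrite /slope Re_dotZr; rewrite /slope in gt0; lra.
by rewrite /qform (linearZ_LR B) /= Re_dotZl Re_dotZr; lra.
Qed.

(** Selfadjointness is what makes the negation usable: [<A x, x>] is real, so
    if it is not nonnegative, then it is negative. *)
Lemma exists_qform_lt0 A : selfadjoint dot A -> ~ possemidef dot A ->
  exists v, qform dot A v < 0.
Proof.
move=> Asa nA; apply: contrapT => nv; apply: nA => x.
have im0 : complex.Im (dot (A x) x) = 0.
  have : dot (A x) x = Num.conj (dot (A x) x).
    by rewrite {1}Asa (hermC dot x (A x)) expr0 mul1r.
  case: (dot (A x) x) => p q [] /= ?; lra.
have : 0 <= qform dot A x by rewrite leNgt; apply/negP => ?; apply: nv; exists x.
rewrite /qform; case: (dot (A x) x) im0 => p q /= -> ?.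
by rewrite lecE /= eqxx.
Qed.

(** Only the sign of the quotients matters: the infimum is negative if and
    only if some quotient is, and the denominators are positive. *)
Lemma lambda_minus_gt0P A B :
  (0 < lambda_minus dot A B)%E <->
  exists v, qform dot A v < 0 /\ 0 < qform dot B v.
Proof.
rewrite /lambda_minus oppe_gt0; split=> [|[v [Av Bv]]].
  move=> /ereal_inf_lt[_ [v /= Bv <-]]; rewrite lte_fin => quot_lt0.
  by exists v; split=> //; rewrite pmulr_llt0 ?invr_gt0 in quot_lt0.
apply: (@le_lt_trans _ _ (qform dot A v / qform dot B v)%:E).
  by apply: ereal_inf_lbound; exists v.
by rewrite lte_fin pmulr_llt0 ?invr_gt0.
Qed.

(** At an interior minimizer, a direction of negative curvature of [f] would
    give a short feasible step that lowers [f]. *)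
Lemma Wset_active A B beta a b w v :
    selfadjoint dot A -> selfadjoint dot B ->
  Wset dot A B beta a b w -> qform dot A v < 0 -> quadfun dot B b w = beta.
Proof.
move=> Asa Bsa [/= gw minw] Av; apply/eqP; rewrite eq_le gw leNgt.
apply/negP => gw_lt.
have [u slope_u qu] := exists_slope_le0 A a w v; rewrite -qu in Av.
have m_gt0 : 0 < beta - quadfun dot B b w by rewrite subr_gt0.
have [t t_gt0 step] :=
  exists_quadratic_le (slope B b w u) (qform dot B u) m_gt0.
have slope_t : t * slope A a w u <= 0 by rewrite pmulr_rle0.
have curv_t : t ^+ 2 * qform dot A u < 0 by rewrite pmulr_rlt0 ?exprn_gt0.
have : quadfun dot A a w <= quadfun dot A a (w + t%:C *: u).
  by apply: minw; rewrite /= quadfun_line //; lra.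
rewrite quadfun_line //; lra.
Qed.

(** Otherwise a long step along [v], in the direction where [g] has
    nonpositive slope, would stay feasible and lower [f]. *)
Lemma Wset_qform_gt0 A B beta a b w v :
    selfadjoint dot A -> selfadjoint dot B ->
  Wset dot A B beta a b w -> qform dot A v < 0 -> 0 < qform dot B v.
Proof.
move=> Asa Bsa [/= gw minw] Av; rewrite ltNge; apply/negP => Bv.
have [u slope_u qu] := exists_slope_le0 B b w v; rewrite -!qu in Av Bv.
have [t t_gt0 step] := exists_quadratic_lt0 (slope A a w u) Av.
have slope_t : t * slope B b w u <= 0 by rewrite pmulr_rle0.
have curv_t : t ^+ 2 * qform dot B u <= 0 by rewrite pmulr_rle0 ?exprn_gt0.
have : quadfun dot A a w <= quadfun dot A a (w + t%:C *: u).
  by apply: minw; rewrite /= quadfun_line //; lra.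
rewrite quadfun_line //; lra.
Qed.

(** Every point with [g < beta] is joined, along a line on which [f] is concave
    and [g] is unbounded above in both directions, to a point of the boundary
    [g = beta] at which [f] is not larger. *)
Lemma Zset_sub_Wset A B beta a b v :
    selfadjoint dot A -> selfadjoint dot B ->
    qform dot A v < 0 -> 0 < qform dot B v ->
  Zset dot A B beta a b `<=` Wset dot A B beta a b.
Proof.
move=> Asa Bsa Av Bv z [/= gz minz]; split=> [|y /=]; first by rewrite /= gz.
rewrite le_eqVlt => /orP[/eqP/minz //|gy].
have [u slope_u qu] := exists_slope_le0 A a y v; rewrite -!qu in Av Bv.
have m_gt0 : 0 < beta - quadfun dot B b y by rewrite subr_gt0.
have [t t_gt0 step] := exists_quadratic_eq (slope B b y u) Bv m_gt0.
have slope_t : t * slope A a y u <= 0 by rewrite pmulr_rle0.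
have curv_t : t ^+ 2 * qform dot A u < 0 by rewrite pmulr_rlt0 ?exprn_gt0.
have : quadfun dot A a z <= quadfun dot A a (y + t%:C *: u).
  by apply: minz; rewrite /= quadfun_line //; lra.
rewrite quadfun_line //; lra.
Qed.

End QuadraticFunctions.

Unset Implicit Arguments.
Set Strict Implicit.

Theorem theorem3p5 (R : realType) (H : completeNormedModType R[i])
    (dot : {dot H for (@Num.conj R[i])})
    (Hnorm : inner_product_norm dot) (Hsep : separable_space H)
    (A B : {linear H -> H})
    (Abnd : bounded_operator A) (Bbnd : bounded_operator B)
    (Asa : selfadjoint dot A) (Bsa : selfadjoint dot B)
    (Aind : indefinite dot A) (Bind : indefinite dot B)
    (beta : R) (a b : H) :
  (Wset dot A B beta a b !=set0 <->
     Zset dot A B beta a b !=set0 /\ (0 < lambda_minus dot A B)%E) /\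
  (Wset dot A B beta a b !=set0 ->
     Wset dot A B beta a b = Zset dot A B beta a b).
Proof.
have [v Av] := exists_qform_lt0 Asa Aind.1.
have W_sub_Z : Wset dot A B beta a b `<=` Zset dot A B beta a b.
  move=> w Ww; split; first exact: (Wset_active Asa Bsa Ww Av).
  by move=> y /= gy; apply: Ww.2; rewrite /= gy.
split; first split.
- move=> [w Ww]; split; first by exists w; exact: W_sub_Z.
  apply/lambda_minus_gt0P; exists v; split=> //.
  exact: (Wset_qform_gt0 Asa Bsa Ww Av).
- move=> [[z Zz] /lambda_minus_gt0P[u [Au Bu]]].
  by exists z; exact: (Zset_sub_Wset Asa Bsa Au Bu Zz).
move=> [w Ww]; apply/seteqP; split=> //.
exact: (Zset_sub_Wset Asa Bsa Av (Wset_qform_gt0 Asa Bsa Ww Av)).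
Qed.
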